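(* Let $a,b$ be positive integers and let $G$ be a finite $(a,b)$--biregular bipartite graph. Then $$\lambda_G(p)\geq\mathcal{G}_{a,b}(p)$$ for every $0\leq p\leq\min\left(\frac{a}{a+b},\frac{b}{a+b}\right)$.
   Context: An $(a,b)$--biregular bipartite graph has bipartition $(A,B)$ with all vertices of $A$ of degree $a$ and all of $B$ of degree $b$. $H(q)=-(q\ln q+(1-q)\ln(1-q))$, $H(0)=H(1)=0$, and $\mathcal{G}_{a,b}(p)=\frac{a}{a+b}H\left(\frac{a+b}{2a}p\right)+\frac{b}{a+b}H\left(\frac{a+b}{2b}p\right)+\frac12p\ln(ab)-\frac{ab}{a+b}H\left(\frac{a+b}{2ab}p\right)$. For a finite graph $G$ with $m_k(G)$ matchings of size $k$, $M(G,t)=\sum_km_k(G)t^k$, $p(G,t)=\frac{2t\,\frac{d}{dt}M(G,t)}{v(G)M(G,t)}$ ($t\geq0$); with $\nu(G)$ the maximum matching size and $p^*=2\nu(G)/v(G)$, $p(G,\cdot)$ is a strictly increasing bijection $[0,\infty)\to[0,p^* )$ with inverse $t(G,p)$; $\lambda_G(p)=\frac{\ln M(G,t(G,p))}{v(G)}-\frac12p\ln t(G,p)$ for $0\leq p<p^*$ (value $0$ at $p=0$), $\lambda_G(p^* )=\lim_{p\nearrow p^*}\lambda_G(p)$, $\lambda_G(p)=0$ for $p>p^*$. *)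

(* Defs.v *)
From HB Require Import structures.
From mathcomp Require Import all_boot all_order all_algebra.
From mathcomp Require Import all_classical all_reals all_analysis.
Set Implicit Arguments. Unset Strict Implicit. Unset Printing Implicit Defensive.
Import Order.TTheory GRing.Theory Num.Theory numFieldNormedType.Exports.
Local Open Scope ring_scope.

Section Matchings.
Variable T : finType.
Variable e : rel T.

(* E is an edge of the graph (e : symmetric irreflexive relation on T) *)
Definition is_edge (E : {set T}) : bool :=
  [exists x, exists y, e x y && (E == [set x; y])].

Definition is_matching (M : {set {set T}}) : bool :=
  [forall E in M, is_edge E] &&
  [forall E1 in M, forall E2 in M, (E1 != E2) ==> [disjoint E1 & E2]].

Definition nmatch (k : nat) : nat :=
  #|[set M : {set {set T}} | is_matching M && (#|M| == k)]|.

Definition numatch : nat := \max_(M : {set {set T}} | is_matching M) #|M|.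

Definition nvert : nat := #|T|.

Variable R : realType.

(* M(G,t) = sum_k m_k(G) t^k  (matchings have size <= v(G)) *)
Definition matchpoly : {poly R} :=
  \sum_(k < #|T|.+1) (nmatch k)%:R *: 'X^k.

Definition pG (t : R) : R :=
  2 * t * (deriv matchpoly).[t] / ((nvert)%:R * matchpoly.[t]).

Definition pstar : R := 2 * (numatch)%:R / (nvert)%:R.

(* t(G,p): the inverse of p(G,.) : [0,oo) -> [0,pstar), i.e. the t >= 0 with p(G,t) = p *)
Definition tG (p : R) : R := xget 0 [set t : R | 0 <= t /\ pG t = p].

Definition lambda0 (p : R) : R :=
  if p == 0 then 0
  else ln (matchpoly.[tG p]) / (nvert)%:R - p / 2 * ln (tG p).

Definition lambdaG (p : R) : R :=
  if p < pstar then lambda0 p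
  else if p == pstar then lim (lambda0 @ at_left pstar)%classic
  else 0.

End Matchings.

Definition biregular_bipartite (T : finType) (e : rel T) (a b : nat) : Prop :=
  exists A : {set T},
    (forall x y, e x y -> (x \in A) != (y \in A)) /\
    (forall x, x \in A -> #|[set y | e x y]| = a) /\
    (forall x, x \notin A -> #|[set y | e x y]| = b).

Section Entropy.
Variable R : realType.

Definition Hent (q : R) : R :=
  if (q == 0) || (q == 1) then 0
  else - (q * ln q + (1 - q) * ln (1 - q)).

Definition Gab (a b : nat) (p : R) : R :=
  let a' := a%:R in let b' := b%:R in
  a' / (a' + b') * Hent ((a' + b') / (2 * a') * p)
  + b' / (a' + b') * Hent ((a' + b') / (2 * b') * p)
  + 1 / 2 * p * ln (a' * b')
  - a' * b' / (a' + b') * Hent ((a' + b') / (2 * a' * b') * p).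
End Entropy.

(* Main.v *)
(** Put [al = p (a + b) / (2 a b)], the fraction of edges in a matching of
    density [p].  Attach to each edge [e] joining [u] in A to [v] in B variables
    [y_e], [z_e], and interpolate between
      [prod_(u in A) (1 + sum_(e at u) y_e) * prod_(v in B) (1 + t sum_(e at v) z_e)]
    and [M(G, t)] by replacing, one edge at a time, a polynomial
    [A + B y_e + C z_e + D y_e z_e] by [A + D].  If the former is at least
    [K (y_e z_e)^al] for all positive [y_e, z_e], the latter is at least
    [K al^al (1 - al)^(1 - al)], provided that [B C <= A D].  This holds as the
    polynomials met are matching sums with vertex weights, and in a bipartite
    graph [Z(G - u) Z(G - v) <= Z(G) Z(G - u - v)] for [u], [v] on opposite sides.
    The initial product is bounded below by weighted AM-GM at each vertex, and
    collecting constants gives, for every [t > 0],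
      [ln M(G, t) >= v(G) (Gab p + p / 2 ln t)],
    as soon as [a al, b al < 1].  Applied at [3 p / 2] with [t] large this yields
    [p < p*]; applied at [p] with [t = t(G, p)] it is the theorem. *)

Require Import Defs.
From HB Require Import structures.
From mathcomp Require Import all_boot all_order all_algebra.
From mathcomp Require Import all_classical all_reals all_analysis.
From mathcomp Require Import ring lra.
From mathcomp Require polyrcf.
Import Order.TTheory GRing.Theory Num.Theory.
Local Open Scope ring_scope.

(** * Weighted matching sums and their correlation inequality *)

(* The sum of [t ^ #|M| * prod w x] over the matchings [M] of the subgraph of [L]
   induced on [D], where [x] runs over the vertices of [D] that [M] misses. *)
Fixpoint wmatch {R : comNzRingType} {T : finType} (t : R) (w : T -> R)
    (L : seq (T * T)) (D : {set T}) : R :=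
  if L is e :: L' then
    wmatch t w L' D +
    (if (e.1 \in D) && (e.2 \in D) then t * wmatch t w L' (D :\ e.1 :\ e.2) else 0)
  else \prod_(x in D) w x.

Lemma setD1AC {T : finType} (D : {set T}) (x y : T) : D :\ x :\ y = D :\ y :\ x.
Proof. by rewrite !finset.setDDl finset.setUC. Qed.

Lemma eq_in_wmatch {R : comNzRingType} {T : finType} (t : R) (w w' : T -> R)
    (L : seq (T * T)) (D : {set T}) :
  {in D, w =1 w'} -> wmatch t w L D = wmatch t w' L D.
Proof.
elim: L D => [|e L IH] D h /=; first exact: eq_bigr.
rewrite (IH D) //; case: ifP => // _; rewrite (IH (D :\ e.1 :\ e.2)) // => x.
by rewrite !inE => /and3P[_ _ /h].
Qed.

(** Each term is affine in the weight of [u], which is a factor exactly when the matching misses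
    [u]; the slope is thus the sum over [D :\ u]. Applied at both ends of an edge, this produces the
    form [A + B y + C z + D y z]. *)
Lemma wmatch_addw {R : comNzRingType} {T : finType} (t : R) (w : T -> R)
    (L : seq (T * T)) (D : {set T}) (u : T) (d : R) : u \in D ->
  wmatch t (fun x => w x + (if x == u then d else 0)) L D =
  wmatch t w L D + d * wmatch t w L (D :\ u).
Proof.
elim: L D => [|e L IH] D uD /=.
  rewrite !(big_setD1 u uD) /= eqxx mulrDl; congr (_ * _ + _ * _).
    by apply: eq_bigr => x; rewrite !inE => /andP[/negbTE -> _]; rewrite addr0.
  by apply: eq_bigr => x; rewrite !inE => /andP[/negbTE -> _]; rewrite addr0.
rewrite IH // !inE.
have [->|u1] := eqVneq e.1 u.
  rewrite /= addr0; case: ifP => _; last by rewrite addr0; ring.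
  rewrite (eq_in_wmatch _ _ w); first by ring.
  by move=> x; rewrite !inE => /and3P[_ /negbTE -> _]; rewrite addr0.
have [->|u2] := eqVneq e.2 u.
  rewrite /= andbF addr0; case: ifP => _; last by ring.
  rewrite (eq_in_wmatch _ _ w); first by ring.
  by move=> x; rewrite !inE => /andP[/negbTE -> _]; rewrite addr0.
rewrite /=; case: ifP => _; last by ring.
rewrite IH; last by rewrite !inE (eq_sym u) u2 (eq_sym u) u1.
have -> : D :\ u :\ e.1 :\ e.2 = D :\ e.1 :\ e.2 :\ u.
  by rewrite (setD1AC _ u) (setD1AC _ u).
by ring.
Qed.

Lemma sum_pick {R : comNzRingType} {T : finType} (D : {set T}) (u q : T) (F : T -> R) :
  q != u -> \sum_(x in D :\ u) (x == q)%:R * F x = if q \in D then F q else 0.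
Proof.
move=> qu; have [qD|qD] := boolP (q \in D); last first.
  rewrite big1 // => x; rewrite !inE => /andP[_ xD].
  by have /negbTE -> : x != q; [apply: contra qD => /eqP <-|rewrite mul0r].
rewrite (bigD1 q) /= ?inE ?qu // eqxx mul1r big1 ?addr0 // => x.
by move=> /andP[_ /negbTE ->]; exact: mul0r.
Qed.

(** Counting both orientations and repetitions makes the expansion at a vertex exact for any
    loopless list. *)
Definition edge_mult {T : finType} (L : seq (T * T)) (u x : T) : nat :=
  (count_mem (u, x) L + count_mem (x, u) L)%N.

(** A matching either misses [u] or contains exactly one edge from [u] to some [x]. Since [wmatch]
    recurses on edges, the induction distinguishes whether the head edge starts at [u], ends at [u]
    or avoids it. *)
Lemma wmatch_expand {R : comNzRingType} {T : finType} (t : R) (w : T -> R)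
    (L : seq (T * T)) (D : {set T}) (u : T) :
  all (fun e => e.1 != e.2) L -> u \in D ->
  wmatch t w L D = w u * wmatch t w L (D :\ u) +
    t * \sum_(x in D :\ u) (edge_mult L u x)%:R * wmatch t w L (D :\ u :\ x).
Proof.
elim: L D => [|[p q] L IH] D /=.
  move=> _ uD; rewrite (big_setD1 u uD) /= [X in t * X]big1 ?mulr0 ?addr0 // => x _.
  by rewrite mul0r.
move=> /andP[pq hL] uD.
have [pu|pu] := eqVneq p u.
  rewrite {p}pu in pq *; rewrite uD /= !inE eqxx /= addr0 IH //.
  have -> : \sum_(x in D :\ u) (edge_mult ((u, q) :: L) u x)%:R *
       (wmatch t w L (D :\ u :\ x) +
        (if (u \in D :\ u :\ x) && (q \in D :\ u :\ x)
         then t * wmatch t w L (D :\ u :\ x :\ u :\ q) else 0)) =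
     \sum_(x in D :\ u) ((x == q)%:R * wmatch t w L (D :\ u :\ x) +
         (edge_mult L u x)%:R * wmatch t w L (D :\ u :\ x)).
    apply: eq_bigr => x; rewrite !inE => /andP[xu _]; rewrite eqxx andbF /= addr0.
    rewrite -mulrDl /edge_mult /= !xpair_eqE eqxx (eq_sym q u) (negbTE pq) andbF /=.
    by rewrite !natrD (eq_sym q); ring.
  rewrite big_split /= mulrDr -addrA; congr (_ + _).
  rewrite addrC; congr (_ + _); rewrite sum_pick; last by rewrite eq_sym.
  by case: ifP => _; rewrite ?mulr0.
have [qu|qu] := eqVneq q u.
  rewrite {q}qu in pq *; rewrite uD /= !inE eqxx /= !andbF andbT /= addr0 IH //.
  have -> : \sum_(x in D :\ u) (edge_mult ((p, u) :: L) u x)%:R *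
       (wmatch t w L (D :\ u :\ x) +
        (if (p \in D :\ u :\ x) && (u \in D :\ u :\ x)
         then t * wmatch t w L (D :\ u :\ x :\ p :\ u) else 0)) =
     \sum_(x in D :\ u) ((x == p)%:R * wmatch t w L (D :\ u :\ x) +
         (edge_mult L u x)%:R * wmatch t w L (D :\ u :\ x)).
    apply: eq_bigr => x; rewrite !inE => /andP[xu _]; rewrite eqxx !andbF /= addr0.
    rewrite -mulrDl /edge_mult /= !xpair_eqE eqxx (negbTE pq) /= andbT.
    by rewrite !natrD (eq_sym p); ring.
  rewrite big_split /= mulrDr -addrA; congr (_ + _).
  rewrite addrC; congr (_ + _); rewrite sum_pick; last by rewrite pu.
  by case: ifP => _; rewrite ?mulr0 // setD1AC.
have em x : edge_mult ((p, q) :: L) u x = edge_mult L u x.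
  by rewrite /edge_mult /= !xpair_eqE (negbTE pu) (negbTE qu) andbF.
rewrite (IH D) // !inE pu qu /=; under [in RHS]eq_bigr do rewrite em mulrDr.
rewrite big_split /=.
have [/andP[pD qD]|npq] := boolP ((p \in D) && (q \in D)); last first.
  rewrite [X in _ + t * (_ + X)]big1 ?addr0 // => x _; rewrite ifN ?mulr0 // !inE.
  by apply: contra npq => /andP[/and3P[_ _ ->] /and3P[_ _ ->]].
rewrite (IH (D :\ p :\ q)) //; last by rewrite !inE eq_sym qu eq_sym pu.
have -> : D :\ p :\ q :\ u = D :\ u :\ p :\ q by rewrite (setD1AC _ u) (setD1AC _ u).
(* A matching using the head edge cannot also join [u] to [p] or [q], so these two terms vanish; in
   the others the deletions commute. *)
suff -> : \sum_(x in D :\ u) (edge_mult L u x)%:R *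
     (if (p \in D :\ u :\ x) && (q \in D :\ u :\ x)
      then t * wmatch t w L (D :\ u :\ x :\ p :\ q) else 0) =
   \sum_(x in D :\ u :\ p :\ q) t * ((edge_mult L u x)%:R *
        wmatch t w L (D :\ u :\ p :\ q :\ x)).
  by rewrite -big_distrr /=; ring.
rewrite [LHS](bigID [in D :\ u :\ p :\ q]) /= [X in _ + X]big1 ?addr0.
  apply: eq_big => x; first by rewrite !inE; case: (x == u); case: (x == p); case: (x == q); rewrite ?andbF ?andbT ?andbb.
  rewrite !inE => /andP[_ /and4P[xq xp _ _]].
  rewrite ![_ == x]eq_sym xq xp pu qu pD qD /= mulrCA.
  do 2 congr (_ * _); congr (wmatch _ _ _ _).
  by rewrite (setD1AC _ x) (setD1AC _ x).
move=> x; rewrite !inE => /andP[/andP[xu xD]]; rewrite xu xD !andbT.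
rewrite ![_ == x]eq_sym => h; rewrite ifN ?mulr0 //; apply: contra h.
by move=> /andP[/and3P[-> _ _] /and3P[->]].
Qed.

Lemma wmatch_gt0 {R : realFieldType} {T : finType} (t : R) (w : T -> R)
    (L : seq (T * T)) (D : {set T}) :
  0 < t -> (forall x, 0 < w x) -> 0 < wmatch t w L D.
Proof.
move=> t0 w0; elim: L D => [|e L IH] D /=; first by apply: prodr_gt0.
case: ifP => _; last by rewrite addr0.
by rewrite addr_gt0 // mulr_gt0.
Qed.

(* Expanding both factors at [u] turns the difference of the two sides into a
   nonnegative combination of the same differences for [D :\ u], with [u]
   replaced by its neighbours; passing to the other side flips the sign. *)
Lemma wmatch_corr {R : realFieldType} {T : finType} (t : R) (w : T -> R)
    (A : {set T}) (L : seq (T * T)) (D : {set T}) (u v : T) :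
  0 < t -> (forall x, 0 < w x) ->
  all (fun e => (e.1 \in A) && (e.2 \notin A)) L ->
  u \in D -> v \in D -> u != v ->
  if (u \in A) == (v \in A)
  then wmatch t w L D * wmatch t w L (D :\ u :\ v) <=
       wmatch t w L (D :\ u) * wmatch t w L (D :\ v)
  else wmatch t w L (D :\ u) * wmatch t w L (D :\ v) <=
       wmatch t w L D * wmatch t w L (D :\ u :\ v).
Proof.
move=> t0 w0 LA.
have Lne : all (fun e => e.1 != e.2) L.
  apply: sub_all LA => e /andP[e1 e2]; apply: contraNneq e2 => <- //.
have em0 x y : (x \in A) = (y \in A) -> edge_mult L x y = 0%N.
  move=> xy; rewrite /edge_mult !(count_memPn _) //;
    by apply/negP => /(allP LA) /=; rewrite xy; case: (_ \in A).
elim: {D}_.+1 {-2}D (ltnSn #|D|) u v => // n IH D Dn u v uD vD uv.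
set Z := wmatch t w L.
have vDu : v \in D :\ u by rewrite !inE eq_sym uv vD.
have uDv : u \in D :\ v by rewrite !inE uv uD.
pose S := \sum_(x in D :\ u :\ v) (edge_mult L u x)%:R *
  (Z (D :\ u :\ x) * Z (D :\ u :\ v) - Z (D :\ u) * Z (D :\ u :\ v :\ x)).
(* Expanding [Z D] and [Z (D :\ v)] at [u], the [w u] terms cancel; the neighbour [v] leaves the
   square, the others leave [S]. *)
have key : Z D * Z (D :\ u :\ v) - Z (D :\ u) * Z (D :\ v) =
    t * ((edge_mult L u v)%:R * Z (D :\ u :\ v) ^+ 2 + S).
  rewrite /Z (wmatch_expand t w L D u) // (wmatch_expand t w L (D :\ v) u) // -/Z.
  rewrite (big_setD1 v vDu) /= (setD1AC D v u).
  have -> : S = (\sum_(x in D :\ u :\ v) (edge_mult L u x)%:R * Z (D :\ u :\ x))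
        * Z (D :\ u :\ v) - Z (D :\ u) *
       (\sum_(x in D :\ u :\ v) (edge_mult L u x)%:R * Z (D :\ u :\ v :\ x)).
    rewrite big_distrl big_distrr -sumrB /=; apply: eq_bigr => x _; ring.
  by ring.
have Dun : (#|D :\ u| < n)%N by move: Dn; rewrite (cardsD1 u) uD.
(* Induction hypothesis on [D :\ u] for [v] and [x]: as [x] lies opposite [u], the pair [v], [x]
   shares a side exactly when [u], [v] does not. *)
have termE x : x \in D :\ u :\ v -> (u \in A) != (x \in A) ->
    if (u \in A) == (v \in A)
    then Z (D :\ u :\ x) * Z (D :\ u :\ v) <= Z (D :\ u) * Z (D :\ u :\ v :\ x)
    else Z (D :\ u) * Z (D :\ u :\ v :\ x) <= Z (D :\ u :\ x) * Z (D :\ u :\ v).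
  rewrite 2!inE => /andP[xv xDu] ux; move: (IH (D :\ u) Dun v x vDu xDu).
  rewrite eq_sym xv => /(_ isT); rewrite -/Z [Z (D :\ u :\ x) * _]mulrC.
  by move: ux; do 3!case: (_ \in A).
have [sd|sd] := eqVneq (u \in A) (v \in A).
  rewrite -subr_le0 key em0 // mul0r add0r pmulr_rle0 //.
  apply: sumr_le0 => x xD; have [ux|ux] := eqVneq (u \in A) (x \in A).
    by rewrite em0 // mul0r.
  by rewrite mulr_ge0_le0 // subr_le0; have := termE x xD ux; rewrite sd eqxx.
rewrite -subr_ge0 key mulr_ge0 ?(ltW t0) // addr_ge0 //.
  by rewrite mulr_ge0 ?ler0n // sqr_ge0.
apply: sumr_ge0 => x xD; have [ux|ux] := eqVneq (u \in A) (x \in A).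
  by rewrite em0 // mul0r.
by rewrite mulr_ge0 ?ler0n // subr_ge0; have := termE x xD ux; rewrite (negbTE sd).
Qed.

(** * Logarithmic forms of weighted AM-GM *)

(** Concavity of [ln]. Weighted AM-GM is obtained below by adding such bounds with [s] the whole
    sum, so that the linear terms add up to a constant. *)
Lemma ln_tangent {R : realType} (x s : R) :
  0 < x -> 0 < s -> ln x <= ln s + (x / s - 1).
Proof.
move=> x0 s0; have xs : 0 < x / s by rewrite divr_gt0.
have := @le_ln1Dx R (x / s - 1); rewrite addrCA subrr addr0.
rewrite ln_div ?posrE // => h; rewrite -lerBlDl; apply: h; lra.
Qed.

Lemma ln_prodr {R : realType} {I : Type} (s : seq I) (P : pred I) (F : I -> R) :
  (forall i, 0 < F i) -> ln (\prod_(i <- s | P i) F i) = \sum_(i <- s | P i) ln (F i).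
Proof.
move=> F0; elim: s => [|i s IH]; first by rewrite !big_nil ln1.
rewrite !big_cons; case: ifP => _ //.
by rewrite lnM ?posrE ?IH // prodr_gt0.
Qed.

(* The test point [y = r A / B], [z = r B / D] with [r = al / (1 - al)] turns
   the right-hand side into at most [A (1 + r) ^ 2 = A / (1 - al) ^ 2]. *)
Lemma merge_edge {R : realType} (al k A B C D : R) :
  0 < al < 1 -> 0 < A -> 0 < B -> 0 < C -> 0 < D -> B * C <= A * D ->
  (forall y z, 0 < y -> 0 < z ->
    k + al * (ln y + ln z) <= ln (A + y * B + z * C + y * z * D)) ->
  k + (al * ln al + (1 - al) * ln (1 - al)) <= ln (A + D).
Proof.
move=> /andP[al0 al1] A0 B0 C0 D0 BC H.
have be0 : 0 < 1 - al by lra.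
pose r := al / (1 - al); have r0 : 0 < r by rewrite divr_gt0.
have y0 : 0 < r * A / B by rewrite divr_gt0 // mulr_gt0.
have z0 : 0 < r * B / D by rewrite divr_gt0 // mulr_gt0.
have := H _ _ y0 z0.
(* The [y] and [y z] terms are exactly [r A] and [r ^ 2 A]; the [z] term [r B C / D] is at most
   [r A] because [B C <= A D]. *)
have le1 : A + r * A / B * B + r * B / D * C + r * A / B * (r * B / D) * D
    <= A / (1 - al) ^+ 2.
  have -> : A / (1 - al) ^+ 2 = A + r * A + r * A + r ^+ 2 * A.
    by rewrite /r; field; rewrite gt_eqF.
  have -> : r * A / B * B = r * A by field; rewrite gt_eqF.
  have -> : r * A / B * (r * B / D) * D = r ^+ 2 * A by field; rewrite !gt_eqF.
  have -> : r * B / D * C = r * (B * C / D) by field; rewrite gt_eqF.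
  rewrite lerD2r lerD2l ler_pM2l // ler_pdivrMr //.
have pos : 0 < A + r * A / B * B + r * B / D * C + r * A / B * (r * B / D) * D.
  by rewrite !addr_gt0 // !mulr_gt0 // invr_gt0.
have := le1; rewrite -ler_ln ?posrE //; last by rewrite divr_gt0 // exprn_gt0.
rewrite !(ln_div, lnM, lnXn, posrE) ?exprn_gt0 ?mulr_gt0 ?divr_gt0 ?invr_gt0 //.
move=> h1 h2.
have S0 : 0 < A + D by rewrite addr_gt0.
(* The two tangent bounds at [A + D] add up to [(1 - al) ln (A / (1 - al)) + al ln (D / al) <= ln (A
   + D)]. *)
have t1 : (1 - al) * (ln A - ln (1 - al)) <= (1 - al) * (ln (A + D) - 1) + A / (A + D).
  have := ln_tangent (A / (1 - al)) (A + D).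
  rewrite divr_gt0 // S0 ln_div ?posrE // => /(_ isT isT).
  rewrite -(ler_pM2l be0) => /le_trans; apply.
  rewrite le_eqVlt; apply/orP; left; apply/eqP; field.
  by rewrite !gt_eqF.
have t2 : al * (ln D - ln al) <= al * (ln (A + D) - 1) + D / (A + D).
  have := ln_tangent (D / al) (A + D).
  rewrite divr_gt0 // S0 ln_div ?posrE // => /(_ isT isT).
  rewrite -(ler_pM2l al0) => /le_trans; apply.
  rewrite le_eqVlt; apply/orP; left; apply/eqP; field.
  by rewrite !gt_eqF.
have t3 : A / (A + D) + D / (A + D) = 1 by field; rewrite gt_eqF.
have := le_trans h2 h1; lra.
Qed.

(** Weighted AM-GM for the summands [1] and [tau * y i], with weights [1 - size s * al] and [al]. *)
Lemma ln_affine_ge {R : realType} {I : Type} (al tau : R) (s : seq I) (y : I -> R) :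
  0 < al -> (size s)%:R * al < 1 -> 0 < tau -> (forall i, 0 < y i) ->
  al * (\sum_(i <- s) ln (y i)) + (size s)%:R * al * ln tau
    - (1 - (size s)%:R * al) * ln (1 - (size s)%:R * al)
    - (size s)%:R * al * ln al <= ln (1 + tau * \sum_(i <- s) y i).
Proof.
move=> al0 s1 tau0 y0; set S := 1 + tau * _.
have S0 : 0 < S.
  apply: ltr_pwDl; first exact: ltr01.
  by rewrite mulr_ge0 ?(ltW tau0) // sumr_ge0 // => i _; exact: ltW.
(* [S] stays the full sum during the induction: it is the common point of tangency. *)
have sumle : al * (\sum_(i <- s) ln (y i)) + (size s)%:R * al * (ln tau - ln al) <=
    (size s)%:R * al * (ln S - 1) + tau * (\sum_(i <- s) y i) / S.
  elim: (s) => [|i s' IH] /=; first by rewrite !big_nil; lra.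
  rewrite !big_cons -natr1.
  have t1 : al * (ln tau + ln (y i) - ln al) <= al * (ln S - 1) + tau * y i / S.
    have := ln_tangent (tau * y i / al) S.
    rewrite divr_gt0 ?mulr_gt0 // S0 ln_div ?lnM ?posrE ?mulr_gt0 // => /(_ isT isT).
    rewrite -(ler_pM2l al0) => /le_trans; apply.
    rewrite le_eqVlt; apply/orP; left; apply/eqP; field.
    by rewrite !gt_eqF.
  have -> : tau * (y i + \sum_(j <- s') y j) / S =
     tau * y i / S + tau * (\sum_(j <- s') y j) / S by field; rewrite gt_eqF.
  by lra.
set g := (size s)%:R * al in s1 sumle *.
have g0 : 0 < 1 - g by lra.
have t2 : (1 - g) * (- ln (1 - g)) <= (1 - g) * (ln S - 1) + 1 / S.
  have := ln_tangent (1 / (1 - g)) S.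
  rewrite divr_gt0 // S0 ln_div ?ln1 ?posrE // => /(_ isT isT).
  rewrite -(ler_pM2l g0) sub0r => /le_trans; apply.
  rewrite le_eqVlt; apply/orP; left; apply/eqP; field.
  by rewrite !gt_eqF.
have t3 : 1 / S + tau * (\sum_(i <- s) y i) / S = 1.
  by rewrite -mulrDl -/S divff // gt_eqF.
by lra.
Qed.

(** * Interpolation from a product to the matching sum *)

(** The factor [t] sits at the second end only, so that the coefficient of [y e * z e] carries one
    [t], the price of an edge in a matching. *)
Definition vweight {R : realType} {T : finType} (t : R) (s : seq (T * T))
    (y z : T * T -> R) (x : T) : R :=
  1 + \sum_(e <- s | e.1 == x) y e + t * \sum_(e <- s | e.2 == x) z e.

Lemma vweight_gt0 {R : realType} {T : finType} (t : R) (s : seq (T * T))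
    (y z : T * T -> R) (x : T) :
  0 < t -> (forall e, 0 < y e) -> (forall e, 0 < z e) -> 0 < vweight t s y z x.
Proof.
move=> t0 y0 z0; rewrite /vweight -addrA; apply: ltr_pwDl; first exact: ltr01.
by apply: addr_ge0; rewrite ?mulr_ge0 ?(ltW t0) // sumr_ge0 // => e _; exact: ltW.
Qed.

Lemma vweight_cons {R : realType} {T : finType} (t : R) (e : T * T) (s : seq (T * T))
    (y z : T * T -> R) (x : T) :
  vweight t (e :: s) y z x =
  vweight t s y z x + (if x == e.1 then y e else 0) + (if x == e.2 then t * z e else 0).
Proof.
rewrite /vweight !big_cons (eq_sym e.1) (eq_sym e.2).
by case: ifP => _; case: ifP => _; ring.
Qed.

(** Edges of [s] still act through the vertex weights, those of [L] already through matchings. The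
    induction moves the head of [s] to [L], hence [catrev], at a cost given by [merge_edge]. *)
Lemma merge_edges {R : realType} {T : finType} (t al k : R) (A : {set T})
    (s L : seq (T * T)) :
  0 < t -> 0 < al < 1 -> uniq s ->
  all (fun e => (e.1 \in A) && (e.2 \notin A)) s ->
  all (fun e => (e.1 \in A) && (e.2 \notin A)) L ->
  (forall y z, (forall e, 0 < y e) -> (forall e, 0 < z e) ->
    k + al * (\sum_(e <- s) ln (y e) + \sum_(e <- s) ln (z e)) <=
    ln (wmatch t (vweight t s y z) L [set: T])) ->
  k + (size s)%:R * (al * ln al + (1 - al) * ln (1 - al)) <=
    ln (wmatch t (fun=> 1) (catrev s L) [set: T]).
Proof.
move=> t0 al01; elim: s L k => [|e s IH] L k /=.
  move=> _ _ _ /(_ (fun=> 1) (fun=> 1) (fun=> ltr01) (fun=> ltr01)).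
  rewrite !big_nil addr0 mulr0 addr0 mul0r addr0.
  rewrite (eq_in_wmatch _ _ (fun=> 1)) // => x _.
  by rewrite /vweight !big_nil mulr0 !addr0.
move=> /andP[es us] /andP[eA sA] LA H.
rewrite -natr1 mulrDl mul1r (addrC (_ * _)) addrA; apply: IH => //=.
  by rewrite eA.
move=> y z y0 z0.
have [e1A e2A] := andP eA.
have e12 : e.1 != e.2 by apply: contraNneq e2A => <-.
set w := vweight t s y z; have w0 x : 0 < w x by exact: vweight_gt0.
pose Z := wmatch t w L.
rewrite !inE /= addrAC.
(* These are the coefficients of [1], [y e], [z e], [y e * z e]; the first and last add up to
   [wmatch] over [e :: L]. *)
apply: (merge_edge al _ (Z [set: T]) (Z ([set: T] :\ e.1)) (t * Z ([set: T] :\ e.2))) => //.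
- exact: wmatch_gt0.
- exact: wmatch_gt0.
- by rewrite mulr_gt0 // wmatch_gt0.
- by rewrite mulr_gt0 // wmatch_gt0.
(* The condition [B C <= A D] is the correlation inequality for the ends of [e], which lie on
   opposite sides. *)
- rewrite mulrCA [X in _ <= X]mulrCA ler_pM2l //.
  have := wmatch_corr t w A L [set: T] e.1 e.2 t0 w0 LA (finset.in_setT _) (finset.in_setT _) e12.
  by rewrite e1A (negbTE e2A).
move=> y1 z1 y10 z10.
(* Since [e] is not in [s], its two variables can be changed alone. *)
pose y' f := if f == e then y1 else y f; pose z' f := if f == e then z1 else z f.
have y'0 f : 0 < y' f by rewrite /y'; case: ifP.
have z'0 f : 0 < z' f by rewrite /z'; case: ifP.
have sumE (x : T * T -> R) x1 (h : R -> R) P :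
    \sum_(f <- s | P f) h (if f == e then x1 else x f) = \sum_(f <- s | P f) h (x f).
  rewrite big_seq_cond [RHS]big_seq_cond; apply: eq_bigr => f /andP[fs _].
  by rewrite ifN //; apply: contraNneq es => <-.
have := H y' z' y'0 z'0.
rewrite !big_cons /y' /z' !sumE eqxx => h.
apply: le_trans (_ : _ <= _) (le_trans h _); first by lra.
rewrite le_eqVlt; apply/orP; left; apply/eqP; congr ln.
have -> : wmatch t (vweight t (e :: s) y' z') L [set: T] =
  wmatch t (fun x => (w x + (if x == e.1 then y1 else 0)) +
                     (if x == e.2 then t * z1 else 0)) L [set: T].
  apply: eq_in_wmatch => x _; rewrite vweight_cons /y' /z' eqxx.
  by congr (_ + _ + _); rewrite /w /vweight (sumE _ _ id) (sumE _ _ id).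
rewrite wmatch_addw ?inE // wmatch_addw ?inE // wmatch_addw ?inE ?e12 //.
by rewrite /Z (setD1AC _ e.2); ring.
Qed.

Lemma ln_wmatch_ge {R : realType} {T : finType} (t al : R) (A : {set T})
    (L : seq (T * T)) (a b : nat) :
  0 < t -> 0 < al < 1 -> a%:R * al < 1 -> b%:R * al < 1 -> uniq L ->
  all (fun e => (e.1 \in A) && (e.2 \notin A)) L ->
  {in A, forall x, count (fun e => e.1 == x) L = a} ->
  {in ~: A, forall x, count (fun e => e.2 == x) L = b} ->
  #|A|%:R * (- (1 - a%:R * al) * ln (1 - a%:R * al) - a%:R * al * ln al) +
  #|~: A|%:R * (b%:R * al * ln t
                - (1 - b%:R * al) * ln (1 - b%:R * al) - b%:R * al * ln al) +
  (size L)%:R * (al * ln al + (1 - al) * ln (1 - al)) <=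
  ln (wmatch t (fun=> 1) (rev L) [set: T]).
Proof.
move=> t0 al01 aal bal uL LA La Lb; have /andP[al0 _] := al01.
(* [rev L] is [catrev L [::]]: the interpolation starts with no merged edge, where [wmatch] is the
   product of the vertex weights. *)
apply: (merge_edges t al _ A) => // y z y0 z0.
rewrite /= ln_prodr; last by move=> x; exact: vweight_gt0.
rewrite (bigID [in A]) /= (mulrDr al) addrACA.
(* Every edge has one end in [A] and one outside, so grouping by either end counts it once. *)
have sum1 (h : T * T -> R) :
    \sum_(x in A) \sum_(e <- L | e.1 == x) h e = \sum_(e <- L) h e.
  rewrite (exchange_big_dep xpredT) //= big_seq [RHS]big_seq; apply: eq_bigr => e eL.
  rewrite (big_pred1 e.1) // => x; rewrite /= eq_sym; case: eqVneq => [->|_].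
    by have /andP[-> _] := allP LA _ eL.
  by rewrite andbF.
have sum2 (h : T * T -> R) :
    \sum_(x in ~: A) \sum_(e <- L | e.2 == x) h e = \sum_(e <- L) h e.
  rewrite (exchange_big_dep xpredT) //= big_seq [RHS]big_seq; apply: eq_bigr => e eL.
  rewrite (big_pred1 e.2) // => x; rewrite /= eq_sym; case: eqVneq => [->|_].
    by have /andP[_] := allP LA _ eL; rewrite inE => ->.
  by rewrite andbF.
apply: lerD.
  rewrite -sum1 mulr_sumr (mulr_natl _ #|A|) -sumr_const -big_split /=.
  under [leRHS]eq_bigl do rewrite finset.in_setT.
  apply: ler_sum => x xA.
  have -> : vweight t L y z x = 1 + 1 * \sum_(e <- L | e.1 == x) y e.
    rewrite /vweight mul1r (_ : \sum_(e <- L | e.2 == x) z e = 0) ?mulr0 ?addr0 //.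
    rewrite big_seq_cond; apply: big1.
    by move=> e /andP[/(allP LA)/andP[_ e2] /eqP ex]; rewrite -ex (negbTE e2) in xA.
  have := ln_affine_ge al 1 [seq e <- L | e.1 == x] y al0.
  rewrite size_filter La // !big_filter ln1 => /(_ aal ltr01 y0); lra.
rewrite -sum2 mulr_sumr (mulr_natl _ #|~: A|) -sumr_const -big_split /=.
have -> : \sum_(i in [set: T] | i \notin A) ln (vweight t L y z i) =
  \sum_(i in ~: A) ln (vweight t L y z i) by apply: eq_bigl => x; rewrite !inE.
apply: ler_sum => x xA.
have -> : vweight t L y z x = 1 + t * \sum_(e <- L | e.2 == x) z e.
  rewrite /vweight (_ : \sum_(e <- L | e.1 == x) y e = 0) ?addr0 //.
  rewrite big_seq_cond; apply: big1.
  by move=> e /andP[/(allP LA)/andP[e1 _] /eqP ex]; rewrite -ex inE e1 in xA.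
have := ln_affine_ge al t [seq e <- L | e.2 == x] z al0.
by rewrite size_filter Lb // !big_filter => /(_ bal t0 z0); lra.
Qed.

(** * From weighted sums to the matching polynomial *)

Definition edge_sets {T : finType} (L : seq (T * T)) : seq {set T} :=
  [seq [set e.1; e.2] | e <- L].

(** Matchings are split by whether they contain the head edge [E]; those that do are the [E |: M]
    with [M] a matching avoiding the ends of [E]. *)
Lemma wmatch1E {R : comNzRingType} {T : finType} (t : R) (A : {set T})
    (L : seq (T * T)) (D : {set T}) :
  uniq L -> all (fun e => (e.1 \in A) && (e.2 \notin A)) L ->
  wmatch t (fun=> 1) L D =
  \sum_(M : {set {set T}} | [&& M \subset edge_sets L, finset.trivIset M
                              & finset.cover M \subset D]) t ^+ #|M|.
Proof.
elim: L D => [|[u v] L IH] D /=.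
  move=> _ _; rewrite big1_eq (big_pred1 finset.set0) ?cards0 ?expr0 // => M.
  rewrite /edge_sets /=; apply/idP/eqP => [/and3P[M0 _ _]|->].
    by apply/eqP; rewrite -finset.subset0; apply/fintype.subsetP => B /(fintype.subsetP M0).
  apply/and3P; split; first by apply/fintype.subsetP => x; rewrite inE.
    by apply/finset.trivIsetP => B C; rewrite inE.
  by rewrite /finset.cover big_set0 finset.sub0set.
move=> /andP[eL uL] /andP[/= /andP[uA vA] LA].
set E := [set u; v].
(* The orientation from [A] recovers a pair from its set, so [E] does not recur in the tail. *)
have ES : E \notin edge_sets L.
  apply/mapP => -[[p q] pqL Epq].
  have /andP[/= pA qA] := allP LA _ pqL.
  have pE : p \in E by rewrite Epq !inE eqxx.
  have qE : q \in E by rewrite Epq !inE eqxx orbT.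
  have pu : p = u.
    by move: pE; rewrite !inE => /orP[/eqP|/eqP pv] //; rewrite pv (negbTE vA) in pA.
  have qv : q = v.
    by move: qE; rewrite !inE => /orP[/eqP qu|/eqP] //; rewrite qu uA in qA.
  by rewrite pu qv (negbTE eL) in pqL.
rewrite (bigID (fun M : {set {set T}} => E \in M)) /= addrC !IH //; congr (_ + _).
  apply: eq_bigl => M; have [EM|EM] /= := boolP (E \in M).
    rewrite andbF; apply/negbTE; apply: contra ES.
    by move=> /and3P[/fintype.subsetP/(_ _ EM)].
  rewrite andbT; congr (_ && _); apply/fintype.subsetP/fintype.subsetP => h x xM.
    by rewrite inE h ?orbT.
  have := h x xM; rewrite inE => /orP[/eqP xE|//].
  by move: EM; rewrite -/E -xE xM.
have uE : u \in E by rewrite !inE eqxx.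
have vE : v \in E by rewrite !inE eqxx orbT.
have coverE M : finset.cover (E |: M) = E :|: finset.cover M.
  have [EM|EM] := boolP (E \in M); last by rewrite /finset.cover big_setU1.
  rewrite (finset.setUidPr _) ?finset.sub1set //; apply/esym/finset.setUidPr.
  by rewrite /finset.cover; apply: (finset.bigcup_sup E EM).
rewrite [RHS](reindex_onto (fun M => E |: M) (fun M => M :\ E)) /=; last first.
  by move=> M /andP[_ EM]; exact: finset.setD1K.
have [/andP[uD vD]|uvD] := boolP ((u \in D) && (v \in D)); last first.
  rewrite big_pred0 // => M; apply: contraNF uvD.
  rewrite coverE => /andP[/andP[/and3P[_ _ /fintype.subsetP h] _] _].
  by rewrite !h ?inE ?eqxx ?orbT.
rewrite mulr_sumr; apply: eq_big => [M|M /and3P[MS _ _]]; last first.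
  by rewrite cardsU1 (contra (fintype.subsetP MS E) ES) exprS.
rewrite coverE finset.subUset.
have -> : E \subset D by rewrite finset.subUset !finset.sub1set uD vD.
rewrite finset.setU11 andbT /=.
apply/idP/idP => [/and3P[MS tM cM]|/andP[/and3P[MS tM cM] /eqP EM]].
  have EM : E \notin M by exact: contra (fintype.subsetP MS E) ES.
  have disE B : B \in M -> [disjoint E & B].
    move=> BM; rewrite finset.disjoints_subset; apply/fintype.subsetP => x xE.
    rewrite inE; apply/negP => xB.
    have : x \in finset.cover M by apply/finset.bigcupP; exists B.
    move=> /(fintype.subsetP cM); rewrite !inE => /and3P[xv xu _].
    by move: xE; rewrite !inE (negbTE xv) (negbTE xu).
  rewrite finset.setU1K // eqxx andbT; apply/and3P; split.
  - apply/fintype.subsetP => B; rewrite !inE => /orP[->//|/(fintype.subsetP MS) ->].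
    by rewrite orbT.
  - apply/finset.trivIsetP => B C; rewrite !inE.
    move=> /predU1P[->|BM] /predU1P[->|CM]; rewrite ?eqxx //.
    + by move=> _; exact: disE.
    + by move=> _; rewrite disjoint_sym; exact: disE.
    + exact: (finset.trivIsetP tM).
  - apply: fintype.subset_trans cM _.
    by apply: fintype.subset_trans (finset.subD1set _ _) (finset.subD1set _ _).
have EnM : E \notin M by rewrite -EM !inE eqxx.
apply/and3P; split.
- apply/fintype.subsetP => B BM; have BE : B != E by apply: contraNneq EnM => <-.
  have : B \in E :: edge_sets L by apply: (fintype.subsetP MS); rewrite !inE BM orbT.
  by rewrite inE (negbTE BE).
- exact: finset.trivIsetS (finset.subsetUr _ _) tM.
- apply/fintype.subsetP => x xM; have xD := fintype.subsetP cM _ xM.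
  have /finset.bigcupP[B BM xB] := xM.
  have dEB : [disjoint E & B].
    apply: (finset.trivIsetP tM); rewrite ?inE ?eqxx ?BM ?orbT //.
    by apply: contraNneq EnM => ->.
  have xE : x \notin E by apply/negP => xE; have := disjointFr dEB xE; rewrite xB.
  by move: xE; rewrite !inE negb_or xD andbT andbC.
Qed.

Lemma nonempty_trivIset_card {T : finType} (M : {set {set T}}) :
  finset.trivIset M -> {in M, forall B, B != finset.set0} -> (#|M| <= #|T|)%N.
Proof.
move=> /eqP tM M0; apply: leq_trans (max_card (finset.cover M)).
rewrite -tM -sum1_card; apply: leq_sum => B BM; rewrite card_gt0; exact: M0.
Qed.

Section Matchings.
Variables (T : finType) (e : rel T).

Definition oriented_edges (A : {set T}) : seq (T * T) :=
  [seq p <- enum {: T * T} | e p.1 p.2 && (p.1 \in A)].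

Lemma is_matching_trivIset (M : {set {set T}}) :
  is_matching e M -> finset.trivIset M.
Proof.
move=> /andP[_ /forall_inP h]; apply/finset.trivIsetP => B C BM CM BC.
by have /forall_inP/(_ C CM) := h B BM; rewrite BC.
Qed.

Lemma is_edge_neq0 (E : {set T}) : is_edge e E -> E != finset.set0.
Proof.
move=> /existsP[x /existsP[y /andP[_ /eqP ->]]].
by apply/finset.set0Pn; exists x; rewrite !inE eqxx.
Qed.

Lemma is_matching_card (M : {set {set T}}) : is_matching e M -> (#|M| <= #|T|)%N.
Proof.
move=> mM; apply: nonempty_trivIset_card (is_matching_trivIset M mM) _ => B BM.
by have /andP[/forall_inP/(_ _ BM) + _] := mM; exact: is_edge_neq0.
Qed.

Lemma is_matching_oriented (A : {set T}) (M : {set {set T}}) :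
  symmetric e -> (forall x y, e x y -> (x \in A) != (y \in A)) ->
  is_matching e M = (M \subset edge_sets (oriented_edges A)) && finset.trivIset M.
Proof.
move=> se bip.
have edgeE E : is_edge e E = (E \in edge_sets (oriented_edges A)).
  apply/existsP/mapP => [[x /existsP[y /andP[exy /eqP ->]]]|[[x y] + ->]].
    case: (boolP (x \in A)) => xA.
      by exists (x, y) => //; rewrite mem_filter /= exy xA mem_enum.
    exists (y, x); last by rewrite /= finset.setUC.
    rewrite mem_filter /= se exy mem_enum andbT.
    by have := bip _ _ exy; rewrite (negbTE xA); case: (_ \in _).
  rewrite mem_filter /= => /andP[/andP[exy _] _].
  by exists x; apply/existsP; exists y; rewrite exy eqxx.
apply/idP/idP => [mM|/andP[MS tM]].
  rewrite is_matching_trivIset // andbT; apply/fintype.subsetP => E EM.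
  by have /andP[/forall_inP/(_ _ EM) + _] := mM; rewrite edgeE.
apply/andP; split.
  by apply/forall_inP => E EM; rewrite edgeE; exact: (fintype.subsetP MS).
apply/forall_inP => B BM; apply/forall_inP => C CM; apply/implyP => BC.
exact: (finset.trivIsetP tM).
Qed.

Lemma matchpolyE (R : realType) :
  matchpoly e R = \poly_(k < #|T|.+1) (nmatch e k)%:R.
Proof. by rewrite poly_def. Qed.

(** Grouping by size loses nothing, as no matching has more than [#|T|] edges. *)
Lemma horner_matchpoly (R : realType) (t : R) :
  (matchpoly e R).[t] = \sum_(M | is_matching e M) t ^+ #|M|.
Proof.
rewrite matchpolyE horner_poly.
rewrite (partition_big (fun M : {set {set T}} => inord #|M| : 'I_#|T|.+1) xpredT) //=.
apply: eq_bigr => k _; rewrite /nmatch -sum1_card natr_sum mulr_suml.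
apply: eq_big => [M|M]; rewrite inE; last by move=> /andP[_ /eqP ->]; rewrite mul1r.
case: (boolP (is_matching e M)) => //= mM.
by rewrite -val_eqE /= inordK // ltnS is_matching_card.
Qed.

End Matchings.

(** * Double counting and the lower bound on [M(G, t)] *)

Lemma size_sum_count {S T : finType} (f : S -> T) (A : {set T}) (s : seq S) :
  all (fun i => f i \in A) s ->
  size s = (\sum_(x in A) count (fun i => f i == x) s)%N.
Proof.
elim: s => [|i s IH] /=; first by rewrite big1.
move=> /andP[iA sA]; rewrite big_split /= -IH // (bigD1 (f i)) //= eqxx big1 //.
by move=> x /andP[_ xi]; rewrite eq_sym (negbTE xi).
Qed.

Lemma oriented_edges_mem {T : finType} (e : rel T) (A : {set T}) :
  (forall x y, e x y -> (x \in A) != (y \in A)) ->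
  all (fun p => (p.1 \in A) && (p.2 \notin A)) (oriented_edges T e A).
Proof.
move=> bip; apply/allP => -[x y]; rewrite mem_filter /= => /andP[/andP[exy xA] _].
by have := bip _ _ exy; rewrite xA; case: (_ \in _).
Qed.

Lemma count_enum {T : finType} (P : pred T) : count P (enum T) = #|P|.
Proof. by rewrite cardE -size_filter enumT. Qed.

Lemma count_oriented1 {T : finType} (e : rel T) (A : {set T}) (x : T) : x \in A ->
  count (fun p => p.1 == x) (oriented_edges T e A) = #|[set y | e x y]|.
Proof.
move=> xA; rewrite count_filter count_enum.
rewrite -(card_imset [set y | e x y] (f := pair x)); last by move=> y z [].
apply: eq_card => -[y z]; rewrite [LHS]unfold_in /=.
apply/andP/imsetP => [[/eqP -> /andP[exz _]]|[u + [-> ->]]].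
  by exists z; rewrite ?inE.
by rewrite inE eqxx xA andbT.
Qed.

Lemma count_oriented2 {T : finType} (e : rel T) (A : {set T}) (x : T) :
  symmetric e -> (forall x y, e x y -> (x \in A) != (y \in A)) -> x \notin A ->
  count (fun p => p.2 == x) (oriented_edges T e A) = #|[set y | e x y]|.
Proof.
move=> se bip xA; rewrite count_filter count_enum.
rewrite -(card_imset [set y | e x y] (f := fun y => (y, x))); last by move=> y z [].
apply: eq_card => -[y z]; rewrite [LHS]unfold_in /=.
apply/andP/imsetP => [[/eqP -> /andP[eyx _]]|[u + [-> ->]]].
  by exists y; rewrite ?inE // se.
rewrite inE eqxx se => eux; rewrite eux; split=> //.
by have := bip _ _ eux; rewrite (negbTE xA); case: (_ \in A).
Qed.

Lemma matchpoly_gt0 {T : finType} (e : rel T) (R : realType) (t : R) :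
  0 <= t -> 0 < (matchpoly e R).[t].
Proof.
move=> t0; rewrite horner_matchpoly.
have m0 : is_matching e finset.set0.
  by apply/andP; split; apply/forall_inP => B; rewrite inE.
by rewrite (bigD1 finset.set0) //= cards0 expr0 ltr_pwDl // sumr_ge0 // => M _; exact: exprn_ge0.
Qed.

Lemma matchpoly_ge {R : realType} {T : finType} (e : rel T) (a b : nat) (p t : R) :
  (0 < a)%N -> (0 < b)%N -> symmetric e -> biregular_bipartite e a b ->
  0 < p -> p * (a + b)%:R < 2 * a%:R -> p * (a + b)%:R < 2 * b%:R -> 0 < t ->
  (nvert T)%:R * Gab a b p + (nvert T)%:R * p / 2 * ln t <= ln (matchpoly e R).[t].
Proof.
move=> a0 b0 se [A [bip [dA dB]]] p0 pa pb t0.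
have ar : 0 < a%:R :> R by rewrite ltr0n.
have br : 0 < b%:R :> R by rewrite ltr0n.
have a1 : 1 <= a%:R :> R by rewrite ler1n.
rewrite natrD in pa pb.
pose al := p * (a%:R + b%:R) / (2 * a%:R * b%:R).
have ab0 : 0 < a%:R + b%:R :> R by rewrite addr_gt0.
have al0 : 0 < al by rewrite divr_gt0 // ?mulr_gt0.
(* [pb] amounts to [a al < 1] and [pa] to [b al < 1]; this keeps the arguments of [Hent] strictly
   between [0] and [1]. *)
have aal : a%:R * al < 1.
  have -> : a%:R * al = p * (a%:R + b%:R) / (2 * b%:R) by rewrite /al; field; rewrite !gt_eqF.
  by rewrite ltr_pdivrMr ?mulr_gt0 // mul1r.
have bal : b%:R * al < 1.
  have -> : b%:R * al = p * (a%:R + b%:R) / (2 * a%:R) by rewrite /al; field; rewrite !gt_eqF.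
  by rewrite ltr_pdivrMr ?mulr_gt0 // mul1r.
have al1 : al < 1 by apply: le_lt_trans aal; rewrite ler_peMl // ltW.
pose L := oriented_edges T e A.
have LA : all (fun p => (p.1 \in A) && (p.2 \notin A)) L by exact: oriented_edges_mem.
have uL : uniq L by rewrite filter_uniq // enum_uniq.
have La : {in A, forall x, count (fun e => e.1 == x) L = a}.
  by move=> x xA; rewrite count_oriented1 // dA.
have Lb : {in ~: A, forall x, count (fun e => e.2 == x) L = b}.
  by move=> x; rewrite inE => xA; rewrite count_oriented2 // dB.
have sizeA : size L = (#|A| * a)%N.
  rewrite (size_sum_count fst A); first by rewrite (eq_bigr _ La) sum_nat_const.
  by apply: sub_all LA => q /andP[].
have sizeB : size L = (#|~: A| * b)%N.
  rewrite (size_sum_count snd (~: A)); first by rewrite (eq_bigr _ Lb) sum_nat_const.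
  by apply: sub_all LA => q /andP[_]; rewrite inE.
have -> : (matchpoly e R).[t] = wmatch t (fun=> 1) (rev L) [set: T].
  rewrite horner_matchpoly (wmatch1E _ A) ?rev_uniq ?all_rev //.
  apply: eq_bigl => M; rewrite (is_matching_oriented T e A) // finset.subsetT andbT.
  congr (_ && _); apply: eq_subset_r => E.
  by rewrite /edge_sets map_rev mem_rev.
apply: le_trans (ln_wmatch_ge t al A L a b _ _ _ _ _ _ _ _) => //; last by rewrite al0.
(* The two sides are in fact equal: everything is expressed through [#|A|], [a], [b], [al] and
   logarithms, using [#|A| a = #|~: A| b]. *)
rewrite le_eqVlt; apply/orP; left; apply/eqP.
have vE : (nvert T)%:R = #|A|%:R + #|~: A|%:R :> R by rewrite -natrD cardsC.
have mA : (size L)%:R = #|A|%:R * a%:R :> R by rewrite sizeA natrM.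
have nB : #|~: A|%:R = #|A|%:R * a%:R / b%:R :> R.
  by rewrite -mA sizeB natrM mulfK // gt_eqF.
have pE : p = 2 * a%:R * b%:R * al / (a%:R + b%:R) by rewrite /al; field; rewrite !gt_eqF.
have HE (q : R) : 0 < q -> q < 1 -> Hent q = - (q * ln q + (1 - q) * ln (1 - q)).
  by move=> q0 q1; rewrite /Hent gt_eqF // lt_eqF.
rewrite /Gab.
have -> : (a%:R + b%:R) / (2 * a%:R) * p = b%:R * al by rewrite /al; field; rewrite !gt_eqF.
have -> : (a%:R + b%:R) / (2 * b%:R) * p = a%:R * al by rewrite /al; field; rewrite !gt_eqF.
have -> : (a%:R + b%:R) / (2 * a%:R * b%:R) * p = al by rewrite /al; field; rewrite !gt_eqF.
have aal0 : 0 < a%:R * al by exact: mulr_gt0.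
have bal0 : 0 < b%:R * al by exact: mulr_gt0.
rewrite (HE (b%:R * al)) // (HE (a%:R * al)) // (HE al) //.
rewrite (lnM (x := a%:R) (y := b%:R)) ?posrE //.
rewrite (lnM (x := a%:R) (y := al)) ?posrE // (lnM (x := b%:R) (y := al)) ?posrE //.
rewrite vE mA nB pE.
by field; rewrite !gt_eqF.
Qed.

(** * Maximum matchings and the inverse of [pG] *)

Lemma card_le_numatch {T : finType} (e : rel T) (M : {set {set T}}) :
  is_matching e M -> (#|M| <= numatch e)%N.
Proof. by move=> mM; apply: (@leq_bigmax_cond _ (is_matching e) (fun M => #|M|)). Qed.

Lemma nmatch_numatch {T : finType} (e : rel T) : (0 < nmatch e (numatch e))%N.
Proof.
rewrite /numatch; have [|M mM ->] := @eq_bigmax_cond _ (is_matching e) (fun M => #|M|).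
  apply/card_gt0P; exists finset.set0; rewrite unfold_in.
  by apply/andP; split; apply/forall_inP => B; rewrite inE.
by rewrite card_gt0; apply/finset.set0Pn; exists M; rewrite inE eqxx andbT.
Qed.

Lemma nmatch_gt {T : finType} (e : rel T) (k : nat) :
  (numatch e < k)%N -> nmatch e k = 0%N.
Proof.
move=> k_gt; apply/eqP; rewrite cards_eq0; apply/eqP/finset.setP => M; rewrite !inE.
apply/negbTE/negP => /andP[mM /eqP Mk].
by have := card_le_numatch e M mM; rewrite Mk leqNgt k_gt.
Qed.

Lemma matchpoly_le {T : finType} (e : rel T) {R : realType} (t : R) : 1 <= t ->
  (matchpoly e R).[t] <= (matchpoly e R).[1] * t ^+ numatch e.
Proof.
move=> t1; rewrite !horner_matchpoly mulr_suml; apply: ler_sum => M mM.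
by rewrite expr1n mul1r ler_weXn2l // card_le_numatch.
Qed.

(* Comparing growth at infinity: [M(G, t)] is at most [M(G, 1) t ^ nu], but at
   least a constant times [t ^ (3 v p / 4)]. *)
Lemma lt_pstar {R : realType} {T : finType} (e : rel T) (a b : nat) (p : R) :
  (0 < a)%N -> (0 < b)%N -> (0 < #|T|)%N -> symmetric e -> biregular_bipartite e a b ->
  0 < p -> p * (a + b)%:R <= a%:R -> p * (a + b)%:R <= b%:R -> p < pstar e R.
Proof.
move=> a0 b0 T0 se bip p0 pa pb.
have ar : 0 < a%:R :> R by rewrite ltr0n.
have br : 0 < b%:R :> R by rewrite ltr0n.
have v0 : 0 < (nvert T)%:R :> R by rewrite ltr0n.
rewrite /pstar ltr_pdivlMr // ltNge; apply/negP => nu_le.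
(* A factor below [2] keeps the strict hypotheses of [matchpoly_ge]; one above [1] makes the
   exponent [v q / 2] exceed [nu <= v p / 2]. *)
pose q := 3 / 2 * p.
have q0 : 0 < q by rewrite mulr_gt0 // divr_gt0.
have qa : q * (a + b)%:R < 2 * a%:R by rewrite /q -mulrA; lra.
have qb : q * (a + b)%:R < 2 * b%:R by rewrite /q -mulrA; lra.
pose c := ln (matchpoly e R).[1] - (nvert T)%:R * Gab a b q.
(* At [t = expR s] the two bounds force [p v s / 4 <= c], while this [s] makes the left side
   [|c| + 1]. *)
pose s := (`|c| + 1) / (p * (nvert T)%:R / 4).
have pv0 : 0 < p * (nvert T)%:R by rewrite mulr_gt0.
have s0 : 0 < s by rewrite !divr_gt0 // ltr_pwDr.
have t1 : 1 <= expR s :> R by rewrite -expR0 ler_expR ltW.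
have M1 : 0 < (matchpoly e R).[1] by exact/matchpoly_gt0/ler01.
have lo := matchpoly_ge e a b q (expR s) a0 b0 se bip q0 qa qb (expR_gt0 s).
have := matchpoly_le e (expR s) t1.
rewrite -ler_ln ?posrE ?mulr_gt0 ?exprn_gt0 ?matchpoly_gt0 ?expR_gt0 ?expR_ge0 //.
rewrite lnM ?posrE ?exprn_gt0 ?expR_gt0 // lnXn ?expR_gt0 // expRK.
move=> /(le_trans lo); rewrite expRK -(mulr_natl s).
have -> : (nvert T)%:R * q / 2 * s = 3 / 4 * (p * (nvert T)%:R * s) by rewrite /q; field.
have nus : (numatch e)%:R * s <= 1 / 2 * (p * (nvert T)%:R * s).
  by rewrite (mulrA (1 / 2)) ler_pM2r //; lra.
have sE : 1 / 4 * (p * (nvert T)%:R * s) = `|c| + 1 by rewrite /s; field; rewrite !gt_eqF.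
have cle := ler_norm c.
have : c = ln (matchpoly e R).[1] - (nvert T)%:R * Gab a b q by [].
lra.
Qed.

(** [tG] picks a solution of [pG t = p]; one exists by the intermediate value theorem, and it is not
    [0] since [pG] vanishes there. *)
Lemma pG_tG {R : realType} {T : finType} (e : rel T) (p : R) :
  (0 < #|T|)%N -> 0 < p -> p < pstar e R -> 0 < tG e p /\ pG e (tG e p) = p.
Proof.
move=> T0 p0; have v0 : 0 < (nvert T)%:R :> R by rewrite ltr0n.
rewrite /pstar ltr_pdivlMr // => p_lt.
suff [t [t0 pt]] : exists t : R, 0 <= t /\ pG e t = p.
  have [tg0 pg] : 0 <= tG e p /\ pG e (tG e p) = p.
    by apply: (@xgetPex _ 0 [set t : R | 0 <= t /\ pG e t = p]%classic); exists t.
  split=> //; rewrite lt_neqAle tg0 andbT; apply/eqP => t00.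
  by move: pg p0; rewrite -t00 /pG mulr0 !mul0r => <-; rewrite ltxx.
pose M := matchpoly e R; pose vp := p * (nvert T)%:R.
have vp0 : 0 < vp by rewrite mulr_gt0.
(* With denominators cleared, [pG t = p] reads [Q.[t] = 0]. The coefficients [(2 k - v p) m_k] start
   nonpositive and end, at [k = nu], positive because [p < p*]. *)
pose Q := 2 *: ('X * M^`()) - vp *: M.
have Mk k : M`_k = (nmatch e k)%:R.
  rewrite /M matchpolyE coef_poly; case: ltnP => // k_gt.
  rewrite nmatch_gt //; apply: leq_trans k_gt.
  rewrite ltnS; apply/bigmax_leqP => N; exact: is_matching_card.
have Qk k : Q`_k = (2 * k%:R - vp) * (nmatch e k)%:R.
  rewrite /Q coefB !coefZ coefXM coef_deriv !Mk.
  case: k => [|k] /=; first by ring.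
  by rewrite -(mulr_natl (nmatch e k.+1)%:R); ring.
have Qnu : 0 < Q`_(numatch e).
  by rewrite Qk mulr_gt0 ?ltr0n ?nmatch_numatch // subr_gt0.
have sQ : size Q = (numatch e).+1.
  apply/eqP; rewrite eqn_leq; apply/andP; split.
    by apply/leq_sizeP => k k_gt; rewrite Qk nmatch_gt // mulr0.
  rewrite ltnNge; apply/negP => /leq_sizeP/(_ _ (leqnn _)) Q0.
  by rewrite Q0 ltxx in Qnu.
have [n nP] : exists n : R, forall x, x >= n -> Q.[x] >= lead_coef Q.
  by apply: polyrcf.poly_pinfty_gt_lc; rewrite /lead_coef sQ.
(* The maximum with [1] ensures that [[0, x]] is a valid interval. *)
pose x := Num.max n 1.
have x0 : 0 <= x by rewrite le_max ler01 orbT.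
have Qx : 0 < Q.[x].
  by apply: lt_le_trans (nP x _); rewrite ?le_max ?lexx // /lead_coef sQ.
have Q0 : Q.[0] <= 0.
  rewrite horner_coef0 Qk mulr0 sub0r mulNr oppr_le0 mulr_ge0 ?(ltW vp0) //.
have [|t /andP[t0 _] tQ] := @poly_ivt _ Q 0 x x0; first by rewrite Q0 ltW.
exists t; split=> //; move: tQ; rewrite rootE /Q !hornerE subr_eq0 => /eqP tQ.
have M0 : 0 < M.[t] by exact: matchpoly_gt0.
have -> : pG e t = p * (nvert T)%:R * M.[t] / ((nvert T)%:R * M.[t]).
  by rewrite /pG -/M; congr (_ / _).
by field; rewrite !gt_eqF.
Qed.

(** * The bound on [lambdaG] *)

Theorem theorem4p6 (R : realType) (T : finType) (e : rel T) (a b : nat) :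
  (0 < a)%N -> (0 < b)%N -> (0 < #|T|)%N ->
  symmetric e -> irreflexive e ->
  biregular_bipartite e a b ->
  forall p : R, 0 <= p ->
    p <= Num.min (a%:R / (a + b)%:R) (b%:R / (a + b)%:R) ->
    Gab a b p <= lambdaG e p.
Proof.
move=> a0 b0 T0 se _ bip p p0 pmin.
have ar : 0 < a%:R :> R by rewrite ltr0n.
have br : 0 < b%:R :> R by rewrite ltr0n.
have v0 : 0 < (nvert T)%:R :> R by rewrite ltr0n.
have ab0 : 0 < (a + b)%:R :> R by rewrite ltr0n addn_gt0 a0.
set m := Num.min _ _ in pmin.
have m0 : 0 < m by rewrite lt_min !divr_gt0.
(* The whole range lies strictly below [pstar], so [lambdaG] is always given by [lambda0]. *)
have lt_p q : 0 < q -> q <= m -> q < pstar e R.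
  move=> q0; rewrite le_min => /andP[qa qb]; apply: (lt_pstar e a b) => //;
  by rewrite -ler_pdivlMr.
(* At [p = 0] both sides are [0], by the conventions in [lambda0] and [Hent]. *)
have [p_eq0|p_neq0] := eqVneq p 0.
  rewrite p_eq0 /lambdaG (lt_trans m0) ?lt_p // /lambda0 eqxx.
  by rewrite /Gab !mulr0 /Hent !eqxx /= !mulr0 mul0r subr0 !addr0.
have p_gt0 : 0 < p by rewrite lt_neqAle eq_sym p_neq0.
rewrite /lambdaG lt_p // /lambda0 (negbTE p_neq0).
have [t0 _] := pG_tG e p T0 p_gt0 (lt_p p p_gt0 pmin).
move: pmin; rewrite le_min !ler_pdivlMr // => /andP[pa pb].
have := matchpoly_ge e a b p _ a0 b0 se bip p_gt0 _ _ t0.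
rewrite (le_lt_trans pa) ?(le_lt_trans pb) ?ltr_pMl ?ltr1n // => /(_ isT isT) h.
rewrite -(ler_pM2l v0); apply: le_trans (_ : _ <= ln (matchpoly e R).[tG e p] -
   (nvert T)%:R * p / 2 * ln (tG e p)) _; first by rewrite lerBrDr.
rewrite le_eqVlt; apply/orP; left; apply/eqP; field.
by rewrite gt_eqF.
Qed.
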